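(* Let $G$ be a Lie group and let $L$ be a unitary $G$-equivariant holomorphic hermitian line bundle over a compact hermitian manifold $X$ on which $G$ acts by orientation preserving isometries. The geometric character of $L$ computes as the character of the associated representation of $G$ on $\Gamma(L)$: for all $g\in G$, $$\mathrm{ch}_L(g)=\mathrm{Tr}\big(g:\Gamma(L)\to\Gamma(L)\big).$$
   Context: Inner products are linear in the second variable. A hermitian manifold is a complex manifold with a compatible Riemannian metric; a holomorphic hermitian line bundle is a holomorphic line bundle with smoothly varying fibrewise hermitian inner products. $\Gamma(L)$ is the (finite-dimensional) space of holomorphic sections, with $\langle s,s'\rangle=\int_X(s(x),s'(x))\,\mathrm{vol}_x$. Equivariance: there is a lift of the action of $G$ to $L$ by unitary maps $g:L_x\to L_{g\cdot x}$, varying smoothly with $g$ and holomorphically in $x$. $G$ acts on $\Gamma(L)$ by $(g\cdot s)(x)=g\cdot s(g^{-1}\cdot x)$. The Bergman kernel is the family of maps $\langle y|x\rangle:L_x\to L_y$, $\langle y|x\rangle v=\sum_i(s_i(x),v)s_i(y)$, for any orthonormal basis $\{s_i\}$ of $\Gamma(L)$. The associated kernel of $g\in G$ is $\langle y|g|x\rangle=\langle y|g\cdot x\rangle\circ g:L_x\to L_y$. The geometric character of $L$ is the function $$\mathrm{ch}_L(g)=\int_X\langle x|g|x\rangle\,\mathrm{vol}_x,$$ where the endomorphism $\langle x|g|x\rangle$ of the line $L_x$ is identified with a complex number (its trace). *)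

(* Defs.v *)
From HB Require Import structures.
From mathcomp Require Import all_boot all_order all_algebra monoid.
From mathcomp Require Import all_classical all_reals all_analysis.
From mathcomp Require Import complex.

Set Implicit Arguments.
Unset Strict Implicit.
Unset Printing Implicit Defensive.

Import Order.TTheory GRing.Theory Num.Theory.
Import numFieldNormedType.Exports.

Local Open Scope classical_set_scope.
Local Open Scope complex_scope.
Local Open Scope ring_scope.

Fixpoint Ck (R : realType) (m : nat) (W : normedModType R) (k : nat)
    (U : set 'rV[R]_m) (f : 'rV[R]_m -> W) : Prop :=
  if k is k'.+1 then
    (forall z, U z -> differentiable f z) /\ (forall v, Ck k' U ('D_v f))
  else {in U, continuous f}.

(* A regularity class assigns to an open subset of K^m the functions on it
   that are regular; values outside the subset are irrelevant. *)
Definition regularity (K : numFieldType) :=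
  forall (m : nat) (W : normedModType K), set 'rV[K]_m -> ('rV[K]_m -> W) -> Prop.

Definition smooth_on (R : realType) : regularity R :=
  fun m W U f => forall k, Ck k U f.

(* [differentiable] over the field R[i] is complex Frechet differentiability. *)
Definition holomorphic_on (R : realType) : regularity R[i] :=
  fun m W U f => forall z, U z -> differentiable f z.

(* [chart_inv] is only meaningful on the image of [chart_dom]. *)
Record chart (K : numFieldType) (M : topologicalType) (m : nat) := Chart {
  chart_dom : set M;
  chart_fun :> M -> 'rV[K]_m;
  chart_inv : 'rV[K]_m -> M }.

Section Charts.
Variables (K : numFieldType) (reg : regularity K).

Definition chart_cod (M : topologicalType) m (c : chart K M m) : set 'rV[K]_m :=
  c @` chart_dom c.

Definition is_chart (M : topologicalType) m (c : chart K M m) : Prop :=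
  [/\ open (chart_dom c), open (chart_cod c),
      {in chart_dom c, cancel c (chart_inv c)},
      {in chart_dom c, continuous c} &
      {in chart_cod c, continuous (chart_inv c)}].

Definition local_expr (M N : topologicalType) m p
    (a : chart K M m) (b : chart K N p) (f : M -> N) : 'rV[K]_m -> 'rV[K]_p :=
  fun z => b (f (chart_inv a z)).

Definition local_dom (M N : topologicalType) m p
    (a : chart K M m) (b : chart K N p) (f : M -> N) : set 'rV[K]_m :=
  [set z | chart_cod a z /\ chart_dom b (f (chart_inv a z))].

Definition is_atlas (M : topologicalType) m (A : set (chart K M m)) : Prop :=
  [/\ forall a, A a -> is_chart a,
      forall x, exists2 a, A a & chart_dom a x &
      forall a b, A a -> A b -> reg (local_dom a b id) (local_expr a b id)].

Definition is_maximal_atlas (M : topologicalType) m (A : set (chart K M m)) : Prop :=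
  is_atlas A /\
  forall c, is_chart c ->
    (forall a, A a -> reg (local_dom a c id) (local_expr a c id) /\
                      reg (local_dom c a id) (local_expr c a id)) ->
    A c.

Definition is_manifold (M : topologicalType) m (A : set (chart K M m)) : Prop :=
  [/\ hausdorff_space M, @second_countable M & is_maximal_atlas A].

(* The atlases here need not be maximal. *)
Definition regular_map (M N : topologicalType) m p
    (A : set (chart K M m)) (B : set (chart K N p)) (f : M -> N) : Prop :=
  continuous f /\
  forall a b, A a -> B b -> reg (local_dom a b f) (local_expr a b f).

Definition regular_fun (M : topologicalType) m (A : set (chart K M m))
    (W : normedModType K) (U : set M) (f : M -> W) : Prop :=
  forall a, A a ->
    reg (chart_cod a `&` (chart_inv a @^-1` U)) (fun z => f (chart_inv a z)).

Definition prod_chart (M N : topologicalType) m p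
    (a : chart K M m) (b : chart K N p) : chart K (M * N)%type (m + p) :=
  Chart (chart_dom a `*` chart_dom b)
        (fun z => row_mx (a z.1) (b z.2))
        (fun w => (chart_inv a (lsubmx w), chart_inv b (rsubmx w))).

Definition prod_atlas (M N : topologicalType) m p
    (A : set (chart K M m)) (B : set (chart K N p)) :
    set (chart K (M * N)%type (m + p)) :=
  [set c | exists a b, [/\ A a, B b & c = prod_chart a b]].

End Charts.

(* No compatibility between the two structures is imposed here: it is part of
   [lieGroup] below. *)
#[short(type="topGroupType")]
HB.structure Definition TopGroup := {G of Group G & Topological G}.

Record lieGroup (R : realType) := LieGroup {
  lie_sort :> topGroupType;
  lie_dim : nat;
  lie_atlas : set (chart R lie_sort lie_dim);
  lie_manifold : is_manifold (@smooth_on R) lie_atlas;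
  lie_mul : regular_map (@smooth_on R) (prod_atlas lie_atlas lie_atlas) lie_atlas
              (fun p : lie_sort * lie_sort => (p.1 * p.2)%g);
  lie_inv : regular_map (@smooth_on R) lie_atlas lie_atlas
              (fun g : lie_sort => (g^-1)%g) }.

Arguments lie_atlas {R} l.

(* Pointed (nonempty) because the measurable types of the library are. *)
Record complexManifold (R : realType) (n : nat) := ComplexManifold {
  cm_sort :> ptopologicalType;
  hol_atlas : set (chart R[i] cm_sort n);
  cm_manifold : is_manifold (@holomorphic_on R) hol_atlas }.

Arguments hol_atlas {R n} c.

Section RealCoordinates.
Variables (R : realType) (n : nat).

Definition c2r (z : 'rV[R[i]]_n) : 'rV[R]_(n + n) :=
  row_mx (map_mx (@complex.Re R) z) (map_mx (@complex.Im R) z).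

Definition r2c (w : 'rV[R]_(n + n)) : 'rV[R[i]]_n :=
  \row_j (w 0 (lshift n j) +i* w 0 (rshift n j)).

Definition real_chart (M : topologicalType) (c : chart R[i] M n) :
    chart R M (n + n) :=
  Chart (chart_dom c) (fun x => c2r (c x)) (fun w => chart_inv c (r2c w)).

(* This atlas of the underlying smooth manifold is not maximal. *)
Definition real_atlas (X : complexManifold R n) : set (chart R X (n + n)) :=
  (real_chart (M := X)) @` hol_atlas X.

(* The matrix, acting on row vectors, of the real differential of f at x in the
   given complex charts at x and f x. *)
Definition real_jacobian (X : complexManifold R n) (a b : chart R[i] X n)
    (f : X -> X) (x : X) : 'M[R]_(n + n) :=
  jacobian (local_expr (real_chart a) (real_chart b) f) (real_chart a x).

End RealCoordinates.

Arguments real_atlas {R n} X.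

Definition complex_smooth_fun (R : realType) (M : topologicalType) m
    (A : set (chart R M m)) (U : set M) (f : M -> R[i]) : Prop :=
  regular_fun (@smooth_on R) A U (fun x => complex.Re (f x) : R^o) /\
  regular_fun (@smooth_on R) A U (fun x => complex.Im (f x) : R^o).

Definition holomorphic_fun (R : realType) n (X : complexManifold R n)
    (U : set X) (f : X -> R[i]) : Prop :=
  regular_fun (@holomorphic_on R) (hol_atlas X) U (fun x => f x : (R[i])^o).

(* A Riemannian metric is given by its Gram matrices in the charts of the
   (maximal) atlas, for the coordinate basis of R^n x R^n, transforming as a
   covariant 2-tensor; compatibility is invariance under multiplication by i. *)
Record hermitianMetric (R : realType) n (X : complexManifold R n) :=
    HermitianMetric {
  gram :> chart R[i] X n -> X -> 'M[R]_(n + n);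
  gram_sym : forall a x, hol_atlas X a -> chart_dom a x ->
    (gram a x)^T = gram a x;
  gram_pos : forall a x (v : 'rV[R]_(n + n)), hol_atlas X a -> chart_dom a x ->
    v != 0 -> 0 < (v *m gram a x *m v^T) 0 0;
  gram_compatible : forall a x (v w : 'rV[R[i]]_n),
    hol_atlas X a -> chart_dom a x ->
    c2r ('i%C *: v) *m gram a x *m (c2r ('i%C *: w))^T =
    c2r v *m gram a x *m (c2r w)^T;
  gram_smooth : forall a, hol_atlas X a ->
    smooth_on (chart_cod (real_chart a))
      (fun w => gram a (chart_inv (real_chart a) w));
  gram_change : forall a b x, hol_atlas X a -> hol_atlas X b ->
    chart_dom a x -> chart_dom b x ->
    gram a x = real_jacobian a b id x *m gram b x *m (real_jacobian a b id x)^T }.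

Definition is_isometry (R : realType) n (X : complexManifold R n)
    (H : hermitianMetric X) (f : X -> X) : Prop :=
  [/\ bijective f,
      regular_map (@smooth_on R) (real_atlas X) (real_atlas X) f &
      forall a b x, hol_atlas X a -> hol_atlas X b ->
        chart_dom a x -> chart_dom b (f x) ->
        H a x = real_jacobian a b f x *m H b (f x) *m (real_jacobian a b f x)^T].

(* With respect to the orientation given by the complex structure. *)
Definition orientation_preserving (R : realType) n (X : complexManifold R n)
    (f : X -> X) : Prop :=
  forall a b x, hol_atlas X a -> hol_atlas X b ->
    chart_dom a x -> chart_dom b (f x) -> 0 < \det (real_jacobian a b f x).

(* The integral of a nonnegative function with respect to Lebesgue measure on
   R^m, as an iterated integral. *)
Fixpoint lebesgue_int (R : realType) (m : nat) : ('rV[R]_m -> \bar R) -> \bar R :=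
  if m is k.+1 then fun f =>
    (\int[@lebesgue_measure R]_t
       lebesgue_int (fun w : 'rV[R]_k => f (row_mx (const_mx t : 'rV[R]_1) w)))%E
  else fun f => f 0.

Definition borel (T : ptopologicalType) := g_sigma_algebraType (@open T).

Definition is_riemannian_volume (R : realType) n (X : complexManifold R n)
    (H : hermitianMetric X) (vol : {measure set (borel X) -> \bar R}) : Prop :=
  forall a (B : set (borel X)), hol_atlas X a -> measurable B ->
    B `<=` chart_dom a ->
    vol B = lebesgue_int (fun w =>
      (\1_(real_chart a @` B) w *
       Num.sqrt (\det (H a (chart_inv (real_chart a) w))))%:E).

Definition complex_integral (R : realType) d (T : measurableType d)
    (mu : {measure set T -> \bar R}) (f : T -> R[i]) : R[i] :=
  (\int[mu]_x complex.Re (f x))%R +i* (\int[mu]_x complex.Im (f x))%R.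

Definition is_basis_of (K : fieldType) (V : lmodType K) (S : set V) (m : nat)
    (b : 'I_m -> V) : Prop :=
  (forall i, S (b i)) /\
  forall v, S v -> exists! c : 'rV[K]_m, v = \sum_i c 0 i *: b i.

(* The trace of the endomorphism F of the finite-dimensional subspace S of V
   (0 when S has no finite basis, or when S is not stable under F). *)
Definition trace_on (K : fieldType) (V : lmodType K) (S : set V) (F : V -> V) : K :=
  xget 0 [set t | exists m (b : 'I_m -> V) (A : 'M[K]_m),
    [/\ is_basis_of S b, forall j, F (b j) = \sum_i A i j *: b i & t = \tr A]].

Record trivialization (R : realType) n (X : complexManifold R n)
    (fib : X -> lmodType R[i]) := Trivialization {
  tr_dom : set X;
  tr_fun : forall x, fib x -> R[i];
  tr_inv : forall x, R[i] -> fib x }.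

Definition is_trivialization (R : realType) n (X : complexManifold R n)
    (fib : X -> lmodType R[i]) (t : trivialization fib) : Prop :=
  open (tr_dom t) /\
  forall x, tr_dom t x ->
    [/\ linear (tr_fun t (x := x) : fib x -> (R[i])^o),
        cancel (@tr_fun _ _ _ _ t x) (tr_inv t x) &
        cancel (tr_inv t x) (@tr_fun _ _ _ _ t x)].

Record holLineBundle (R : realType) n (X : complexManifold R n) :=
    HolLineBundle {
  fiber :> X -> lmodType R[i];
  trivs : set (trivialization fiber);
  trivsP : forall t, trivs t -> is_trivialization t;
  trivs_cover : forall x, exists2 t, trivs t & tr_dom t x;
  trivs_holomorphic : forall t u, trivs t -> trivs u ->
    holomorphic_fun (tr_dom t `&` tr_dom u)
      (fun x => tr_fun u (tr_inv t x 1)) }.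

Record hermitianStructure (R : realType) n (X : complexManifold R n)
    (L : holLineBundle X) := HermitianStructure {
  herm :> forall x, L x -> L x -> R[i];
  herm_linear : forall x (v : L x), linear (herm v : L x -> (R[i])^o);
  herm_conj : forall x (v w : L x), herm v w = (herm w v)^*%C;
  herm_pos : forall x (v : L x), v != 0 -> 0 < herm v v;
  herm_smooth : forall t, trivs t ->
    complex_smooth_fun (real_atlas X) (tr_dom t)
      (fun x => herm (tr_inv t x 1) (tr_inv t x 1)) }.

Definition sections (R : realType) n (X : complexManifold R n)
  (L : holLineBundle X) := forall x, L x.

Section SectionsLmodule.
Variables (R : realType) (n : nat) (X : complexManifold R n).
Variable L : holLineBundle X.
Local Notation S := (sections L).

HB.instance Definition _ := gen_eqMixin S.
HB.instance Definition _ := gen_choiceMixin S.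

Definition sec_zero : S := fun x => 0.
Definition sec_opp (s : S) : S := fun x => - s x.
Definition sec_add (s t : S) : S := fun x => s x + t x.
Definition sec_scale (c : R[i]) (s : S) : S := fun x => c *: s x.

Let ext (s t : S) : (forall x, s x = t x) -> s = t.
Proof. exact: functional_extensionality_dep. Qed.

Fact sec_addA : associative sec_add.
Proof. by move=> r s t; apply: ext => x; exact: addrA. Qed.
Fact sec_addC : commutative sec_add.
Proof. by move=> s t; apply: ext => x; exact: addrC. Qed.
Fact sec_add0 : left_id sec_zero sec_add.
Proof. by move=> s; apply: ext => x; exact: add0r. Qed.
Fact sec_addN : left_inverse sec_zero sec_opp sec_add.
Proof. by move=> s; apply: ext => x; exact: addNr. Qed.

HB.instance Definition _ :=
  GRing.isZmodule.Build S sec_addA sec_addC sec_add0 sec_addN.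

Fact sec_scaleA c d s : sec_scale c (sec_scale d s) = sec_scale (c * d) s.
Proof. by apply: ext => x; exact: scalerA. Qed.
Fact sec_scale1 : left_id 1 sec_scale.
Proof. by move=> s; apply: ext => x; exact: scale1r. Qed.
Fact sec_scaleDr : right_distributive sec_scale +%R.
Proof. by move=> c s t; apply: ext => x; exact: scalerDr. Qed.
Fact sec_scaleDl s : {morph sec_scale^~ s : c d / c + d}.
Proof. by move=> c d; apply: ext => x; exact: scalerDl. Qed.

HB.instance Definition _ := GRing.Zmodule_isLmodule.Build R[i] S
  sec_scaleA sec_scale1 sec_scaleDr sec_scaleDl.

End SectionsLmodule.

Section BergmanKernel.
Variables (R : realType) (n : nat) (X : complexManifold R n).
Variables (L : holLineBundle X) (h : hermitianStructure L).
Variable vol : {measure set (borel X) -> \bar R}.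

Definition hol_sections : set (sections L) :=
  [set s | forall t, trivs t ->
     holomorphic_fun (tr_dom t) (fun x => tr_fun t (s x))].

Definition section_inner (s s' : sections L) : R[i] :=
  complex_integral vol (fun x : X => h x (s x) (s' x)).

Definition is_orthonormal_basis m (s : 'I_m -> sections L) : Prop :=
  is_basis_of hol_sections s /\
  forall i j, section_inner (s i) (s j) = (i == j)%:R.

Definition bergman_kernel m (s : 'I_m -> sections L) (y x : X) (v : L x) : L y :=
  \sum_i h x (s i x) v *: s i y.

End BergmanKernel.

Arguments hol_sections {R n X} L.

Record lieAction (R : realType) (G : lieGroup R) n (X : complexManifold R n) :=
    LieAction {
  act :> G -> X -> X;
  act_one : forall x, act 1%g x = x;
  act_mul : forall g k x, act (g * k)%g x = act g (act k x);
  act_smooth : regular_map (@smooth_on R)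
    (prod_atlas (lie_atlas G) (real_atlas X)) (real_atlas X)
    (fun p : G * X => act p.1 p.2) }.

Lemma act_invK (R : realType) (G : lieGroup R) n (X : complexManifold R n)
    (a : lieAction G X) (g : G) (x : X) : a g (a (g^-1)%g x) = x.
Proof. by rewrite -act_mul mulgV act_one. Qed.

Definition total_pt (R : realType) n (X : complexManifold R n)
    (L : holLineBundle X) (x : X) (v : L x) : {x : X & L x : Type} :=
  existT (fun x : X => L x : Type) x v.

(* Holomorphy of the lift is expressed in local trivializations: the underlying
   map of X is holomorphic, and so is the coefficient of the lift with respect
   to local frames. *)
Record unitaryLift (R : realType) (G : lieGroup R) n (X : complexManifold R n)
    (L : holLineBundle X) (h : hermitianStructure L) (a : lieAction G X) :=
    UnitaryLift {
  lift :> forall (g : G) (x : X), L x -> L (a g x);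
  lift_linear : forall g x, linear (lift g (x := x));
  lift_one : forall x (v : L x), total_pt (lift 1%g v) = total_pt v;
  lift_mul : forall g k x (v : L x),
    total_pt (lift (g * k)%g v) = total_pt (lift g (lift k v));
  lift_unitary : forall g x (v w : L x), h _ (lift g v) (lift g w) = h _ v w;
  lift_smooth : forall t x (v : L x), trivs t ->
    complex_smooth_fun (lie_atlas G) [set g | tr_dom t (a g x)]
      (fun g => tr_fun t (lift g v));
  lift_base_holomorphic : forall g : G,
    regular_map (@holomorphic_on R) (hol_atlas X) (hol_atlas X) (a g);
  lift_holomorphic : forall (g : G) t u, trivs t -> trivs u ->
    holomorphic_fun (tr_dom t `&` (a g @^-1` tr_dom u))
      (fun x => tr_fun u (lift g (tr_inv t x 1))) }.

Section Characters.
Variables (R : realType) (G : lieGroup R) (n : nat) (X : complexManifold R n).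
Variables (L : holLineBundle X) (h : hermitianStructure L) (a : lieAction G X).
Variable rho : unitaryLift h a.

(* (g . s)(x) = g . s(g^-1 . x), transported along g . (g^-1 . x) = x *)
Definition section_act (g : G) (s : sections L) : sections L :=
  fun x => eq_rect _ (fun y => L y : Type)
             (rho g (a (g^-1)%g x) (s (a (g^-1)%g x))) _ (act_invK a g x).

Definition associated_kernel m (s : 'I_m -> sections L) (g : G) (y x : X)
    (v : L x) : L y :=
  bergman_kernel h s y (rho g x v).

Definition geometric_character (vol : {measure set (borel X) -> \bar R})
    m (s : 'I_m -> sections L) (g : G) : R[i] :=
  complex_integral vol
    (fun x : X => trace_on [set: L x] (@associated_kernel m s g x x)).

End Characters.

(* Main.v *)
Require Import Defs.
From HB Require Import structures.
From mathcomp Require Import all_boot all_order all_algebra monoid.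
From mathcomp Require Import all_classical all_reals all_analysis.
From mathcomp Require Import complex.
From mathcomp Require Import measurable_realfun lra.
Import Order.TTheory GRing.Theory Num.Theory.
Import numFieldNormedType.Exports.

Local Open Scope classical_set_scope.
Local Open Scope complex_scope.
Local Open Scope ring_scope.

Set Implicit Arguments.
Unset Strict Implicit.
Unset Printing Implicit Defensive.

(** The orthonormal basis s_i turns the geometric character into an integral of
    matrix coefficients.  On the line L_x the trace of <x|g|x> is
    sum_i (s_i(gx), g s_i(x)); unitarity of the lift moves g to the left-hand
    argument, so this is sum_i ((g^-1 . s_i)(x), s_i(x)).  Integrating, if B is
    the matrix of g^-1 on Gamma(L) in the basis s_i, orthonormality gives
      ch_L(g) = sum_i <g^-1 . s_i, s_i> = conj (tr B)
    ([geometric_character_trace_inverse]).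

    It remains to compare conj (tr B) with the trace of the matrix A = B^-1 of
    g.  They agree as soon as every eigenvalue of A has modulus 1: A and B can
    be made triangular simultaneously, and then the diagonal entries of B are
    the inverses, i.e. the conjugates, of those of A ([conj_trace_inverse]).
    Unimodularity comes from an invariant norm on Gamma(L).  Rather than the L^2
    norm, whose invariance is a change of variables for the volume, take the
    sup norm, which g preserves pointwise: if g . s = z s with s <> 0, then
    |s(x)|^2 = |z|^2 |s(gx)|^2 for all x, and comparing at a point where the
    continuous function |s|^2 attains its maximum on the compact X forces
    |z| = 1 ([section_act_eigenvalue_norm]).

    The rest is bookkeeping: holomorphic sections have continuous pairings,
    they are stable under the action, and the pairings (s_i, s_j) are
    integrable because each |s_i|^2 has integral 1. *)

(** * Linear maps, bases and traces *)

Section LinearMaps.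
Variables (K : pzRingType) (V W : lmodType K) (f : V -> W).
Hypothesis linf : linear f.

Let fL : {linear V -> W} := HB.pack f (GRing.isLinear.Build _ _ _ _ f linf).

Lemma linear_funZ c v : f (c *: v) = c *: f v.
Proof. by rewrite -[f]/(fL : V -> W) linearZ. Qed.

Lemma linear_fun_sum (I : Type) (r : seq I) (c : I -> K) (v : I -> V) :
  f (\sum_(i <- r) c i *: v i) = \sum_(i <- r) c i *: f (v i).
Proof.
by rewrite -[f]/(fL : V -> W) linear_sum; apply: eq_bigr => i _; rewrite linearZ.
Qed.
End LinearMaps.

Section LinearAlgebra.

(** In a common triangular form of the commuting matrices A and B, the diagonal
    entries of B are the inverses of those of A, and the latter are eigenvalues
    of A, hence of modulus 1. *)
Lemma conj_trace_inverse {C : numClosedFieldType} {m : nat} {A B : 'M[C]_m} :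
    B *m A = 1%:M -> (forall z, eigenvalue A z -> `|z| = 1) ->
  Num.conj (\tr B) = \tr A.
Proof.
move=> BA A1.
have AB : A *m B = 1%:M by exact: mulmx1C.
have [|P /unitarymx_unit Pu] := @cotrigonalization2 _ _ A B; first by rewrite AB BA.
rewrite /similar_to !conjumx // => /andP[].
set A' := P *m A *m invmx P; set B' := P *m B *m invmx P.
move=> tA tB.
have trA : \tr A' = \tr A by rewrite mxtrace_mulC mulmxA mulVmx ?mul1mx.
have trB : \tr B' = \tr B by rewrite mxtrace_mulC mulmxA mulVmx ?mul1mx.
have BA' : B' *m A' = 1%:M.
  by rewrite /B' /A' -!mulmxA mulKmx // (mulmxA B) BA mul1mx mulmxV.
rewrite -trA -trB /mxtrace rmorph_sum; apply: eq_bigr => i _ /=.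
have diag1 : B' i i * A' i i = 1.
  move: (congr1 (fun M : 'M[C]_m => M i i) BA'); rewrite [LHS]mxE [RHS]mxE eqxx.
  rewrite (bigD1 i) //= big1 ?addr0 // => k ki.
  case: (ltngtP k i) => [lt_ki|lt_ik|/val_inj eq_ki].
  - by rewrite (elimT is_trig_mxP tA) // mulr0.
  - by rewrite (elimT is_trig_mxP tB) // mul0r.
  - by rewrite eq_ki eqxx in ki.
have A'1 : `|A' i i| = 1.
  apply: A1; have Pf : row_free P by rewrite row_free_unit.
  apply: (@eigenvalue_conjmx _ _ _ P).
  - by rewrite submx_full // row_full_unit.
  - by [].
  rewrite -topredE /= conjumx // -/A' eigenvalue_root_char.
  rewrite char_poly_trig // (bigD1 i) //= rootM.
  by rewrite root_XsubC eqxx.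
have A'n0 : A' i i != 0 by rewrite -normr_eq0 A'1 oner_neq0.
rewrite -[B' i i](mulfK A'n0) diag1 div1r fmorphV invC_norm conjCK.
by rewrite norm_conjC A'1 expr1n invr1 mul1r.
Qed.

Variables (K : fieldType) (V : lmodType K) (S : set V).

Lemma basis_coords_inj m (b : 'I_m -> V) (c d : 'I_m -> K) : is_basis_of S b ->
    S (\sum_i c i *: b i) ->
  \sum_i c i *: b i = \sum_i d i *: b i -> c =1 d.
Proof.
move=> [_ coord] Sc eq_cd.
have [e [_ uniq]] := coord _ Sc.
have Ec : e = \row_i c i by apply: uniq; apply: eq_bigr => i _; rewrite mxE.
have Ed : e = \row_i d i.
  by apply: uniq; rewrite eq_cd; apply: eq_bigr => i _; rewrite mxE.
by move=> i; move/rowP/(_ i): Ec; rewrite Ed !mxE.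
Qed.

Lemma basis_matrix m p (b : 'I_m -> V) (v : 'I_p -> V) : is_basis_of S b ->
  (forall j, S (v j)) -> exists A : 'M[K]_(m, p), forall j, v j = \sum_i A i j *: b i.
Proof.
move=> [_ coord] Sv.
have /choice[c Ec] : forall j, exists c : 'rV[K]_m, v j = \sum_i c 0 i *: b i.
  by move=> j; have [c [Ec _]] := coord _ (Sv j); exists c.
by exists (\matrix_(i, j) c j 0 i) => j; rewrite Ec; apply: eq_bigr => i _; rewrite mxE.
Qed.

(** Matrices act on coordinate columns: when the columns of A hold the
    coordinates of the v_k in b, multiplying by A converts coordinates with
    respect to v into coordinates with respect to b. *)
Lemma comb_mulmx m p q (b : 'I_m -> V) (v : 'I_p -> V) (A : 'M[K]_(m, p))
    (B : 'M[K]_(p, q)) j : (forall k, v k = \sum_i A i k *: b i) ->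
  \sum_k B k j *: v k = \sum_i (A *m B) i j *: b i.
Proof.
move=> Ev; under eq_bigr do rewrite Ev scaler_sumr.
rewrite exchange_big; apply: eq_bigr => i _; rewrite mxE scaler_suml.
by apply: eq_bigr => k _; rewrite scalerA mulrC.
Qed.

Lemma basis_mx_inj m p (b : 'I_m -> V) (A B : 'M[K]_(m, p)) : is_basis_of S b ->
    (forall j, S (\sum_i A i j *: b i)) ->
    (forall j, \sum_i A i j *: b i = \sum_i B i j *: b i) ->
  A = B.
Proof.
by move=> bS SA AB; apply/matrixP => i j;
  exact: (@basis_coords_inj _ b (A^~ j) (B^~ j) bS (SA j) (AB j)).
Qed.

Lemma basis_mx1 m (b : 'I_m -> V) j : b j = \sum_i (1%:M : 'M[K]_m) i j *: b i.
Proof.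
rewrite (bigD1 j) //= big1 ?addr0 => [|i /negPf ij]; first by rewrite mxE eqxx scale1r.
by rewrite mxE ij scale0r.
Qed.

Lemma basis_change_mulmx m p (b : 'I_m -> V) (b' : 'I_p -> V)
    (P : 'M[K]_(m, p)) (Q : 'M[K]_(p, m)) :
    is_basis_of S b -> (forall j, b' j = \sum_i P i j *: b i) ->
    (forall j, b j = \sum_i Q i j *: b' i) ->
  P *m Q = 1%:M.
Proof.
move=> bS EP EQ.
have E2 j : b j = \sum_i (P *m Q) i j *: b i by rewrite -(comb_mulmx _ _ EP) -EQ.
by apply: (basis_mx_inj bS) => j; rewrite -E2; [exact: bS.1|exact: basis_mx1].
Qed.

(** Independence of the trace from the basis: the transition matrices P and Q
    between two bases are inverse to each other, even though their shapes are
    not known in advance to be square, and the two matrices of F satisfy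
    A P = P A', so that tr A' = tr (Q A P) = tr A. *)
Lemma trace_onE (F : V -> V) m (b : 'I_m -> V) (A : 'M[K]_m) :
    linear F -> is_basis_of S b -> (forall v, S v -> S (F v)) ->
    (forall j, F (b j) = \sum_i A i j *: b i) ->
  trace_on S F = \tr A.
Proof.
move=> linF bS SF FA; apply: xget_unique; first by exists m, b, A.
move=> _ [m' [b' [A' [b'S FA' ->]]]].
have Fcomb := linear_fun_sum linF.
have [P EP] := basis_matrix bS (fun j => b'S.1 j).
have [Q EQ] := basis_matrix b'S (fun j => bS.1 j).
have QP : Q *m P = 1%:M by exact: (basis_change_mulmx b'S EQ EP).
have A'E : A *m P = P *m A'.
  have E3 j : F (b' j) = \sum_i (A *m P) i j *: b i.
    by rewrite EP Fcomb (comb_mulmx _ _ FA).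
  have E4 j : F (b' j) = \sum_i (P *m A') i j *: b i.
    by rewrite FA' (comb_mulmx _ _ EP).
  by apply: (basis_mx_inj bS) => j; rewrite -E3 //; apply: SF; exact: b'S.1.
have PQ : P *m Q = 1%:M by exact: (basis_change_mulmx bS EP EQ).
by rewrite -[A']mul1mx -QP -mulmxA -A'E mxtrace_mulC -mulmxA PQ mulmx1.
Qed.
End LinearAlgebra.

(** * Real and imaginary parts *)

Section ReIm.
Variable R : realType.
Implicit Types z w : R[i].

Lemma ReM z w :
  complex.Re (z * w) = complex.Re z * complex.Re w - complex.Im z * complex.Im w.
Proof. by case: z; case: w. Qed.

Lemma ImM z w :
  complex.Im (z * w) = complex.Re z * complex.Im w + complex.Im z * complex.Re w.
Proof. by case: z; case: w. Qed.

Lemma ReD z w : complex.Re (z + w) = complex.Re z + complex.Re w.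
Proof. by case: z; case: w. Qed.

Lemma ImD z w : complex.Im (z + w) = complex.Im z + complex.Im w.
Proof. by case: z; case: w. Qed.

Lemma normc_ge_Im z : `|complex.Im z|%:C <= `|z|.
Proof.
rewrite normc_def lecR -sqrtr_sqr ler_sqrt ?addr_ge0 ?sqr_ge0 //.
by rewrite lerDr sqr_ge0.
Qed.

End ReIm.

(** * Integrals of complex functions *)

Section ComplexIntegral.
Context {R : realType} d {T : measurableType d} (mu : {measure set T -> \bar R}).

(** [complex_integral] is total, so its linearity needs both components to be
    integrable. *)
Definition complex_integrable (f : T -> R[i]) : Prop :=
  mu.-integrable setT (EFin \o (fun x => complex.Re (f x))) /\
  mu.-integrable setT (EFin \o (fun x => complex.Im (f x))).

Lemma complex_integrableZ c f :
  complex_integrable f -> complex_integrable (fun x => c * f x).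
Proof.
move=> [fR fI]; split.
  rewrite (_ : _ \o _ = (fun x => (complex.Re c)%:E * (complex.Re (f x))%:E) \-
                        (fun x => (complex.Im c)%:E * (complex.Im (f x))%:E))%E.
    by apply: integrableB => //; apply: integrableZl.
  by apply/funext => x /=; rewrite ReM EFinB !EFinM.
rewrite (_ : _ \o _ = (fun x => (complex.Re c)%:E * (complex.Im (f x))%:E) \+
                      (fun x => (complex.Im c)%:E * (complex.Re (f x))%:E))%E.
  by apply: integrableD => //; apply: integrableZl.
by apply/funext => x /=; rewrite ImM EFinD !EFinM.
Qed.

Lemma complex_integralZ c f : complex_integrable f ->
  complex_integral mu (fun x => c * f x) = c * complex_integral mu f.
Proof.
move=> [fR fI]; rewrite /complex_integral.
have Z (r : R) g : mu.-integrable setT (EFin \o g) ->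
    mu.-integrable setT (EFin \o (fun x => r * g x)).
  by move=> ig; rewrite (_ : _ \o _ = (fun x => r%:E * (g x)%:E)%E) //; apply: integrableZl.
apply/eqP; rewrite eq_complex /= ReM ImM /=; apply/andP; split; apply/eqP.
  under eq_Rintegral do rewrite ReM.
  by rewrite RintegralB ?RintegralZl //; exact: Z.
under eq_Rintegral do rewrite ImM.
by rewrite RintegralD ?RintegralZl //; exact: Z.
Qed.

Lemma complex_integrableD f g : complex_integrable f -> complex_integrable g ->
  complex_integrable (fun x => f x + g x).
Proof.
move=> [fR fI] [gR gI]; split.
  rewrite (_ : _ \o _ = (EFin \o (fun x => complex.Re (f x))) \+
                        (EFin \o (fun x => complex.Re (g x))))%E.
    exact: integrableD.
  by apply/funext => x /=; rewrite ReD EFinD.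
rewrite (_ : _ \o _ = (EFin \o (fun x => complex.Im (f x))) \+
                      (EFin \o (fun x => complex.Im (g x))))%E.
  exact: integrableD.
by apply/funext => x /=; rewrite ImD EFinD.
Qed.

Lemma complex_integralD f g : complex_integrable f -> complex_integrable g ->
  complex_integral mu (fun x => f x + g x) =
  complex_integral mu f + complex_integral mu g.
Proof.
move=> [fR fI] [gR gI]; rewrite /complex_integral.
apply/eqP; rewrite eq_complex /=; apply/andP; split; apply/eqP.
  by under eq_Rintegral do rewrite ReD; rewrite RintegralD.
by under eq_Rintegral do rewrite ImD; rewrite RintegralD.
Qed.

Lemma complex_integral_sum (I : Type) (r : seq I) (f : I -> T -> R[i]) :
    (forall i, complex_integrable (f i)) ->
  complex_integrable (fun x => \sum_(i <- r) f i x) /\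
  complex_integral mu (fun x => \sum_(i <- r) f i x) =
  \sum_(i <- r) complex_integral mu (f i).
Proof.
move=> fi; elim: r => [|i r [IHi IH]].
  under eq_fun do rewrite big_nil.
  rewrite big_nil; split.
    by split; apply: integrable0.
  by rewrite /complex_integral /= /Rintegral integral0.
under eq_fun do rewrite big_cons.
rewrite big_cons -IH; split; first exact: complex_integrableD.
exact: complex_integralD.
Qed.

End ComplexIntegral.

Section BorelMeasurable.
Variables (R : realType) (X : ptopologicalType).

Lemma continuous_borel_measurable (f : X -> R) : continuous f ->
  measurable_fun setT (f : borel X -> R).
Proof.
move=> /continuousP cf; apply: (measurability _ (RGenOpens.measurableE R)).
move=> _ [_ [a [b ->] <-]]; apply: sub_sigma_algebra.
rewrite setTI; exact/cf/interval_open.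
Qed.

Lemma dominated_integrable (mu : {measure set (borel X) -> \bar R}) (f F : X -> R) :
    continuous f -> (forall x, `|f x| <= F x) ->
    mu.-integrable setT (EFin \o (F : borel X -> R)) ->
  mu.-integrable setT (EFin \o (f : borel X -> R)).
Proof.
move=> cf fF; apply: le_integrable => //.
  by apply/measurable_EFinP; exact: continuous_borel_measurable.
by move=> x _ /=; rewrite lee_fin (le_trans (fF x)) ?ler_norm.
Qed.

(** The real-valued integral of a nonnegative function is 0 when the extended
    one is infinite, so a nonzero value certifies integrability. *)
Lemma ge0_Rintegral_neq0_integrable (mu : {measure set (borel X) -> \bar R}) (f : X -> R) :
  continuous f -> (forall x, 0 <= f x) -> (\int[mu]_x f x)%R != 0 ->
  mu.-integrable setT (EFin \o (f : borel X -> R)).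
Proof.
move=> cf f0 nz; apply/integrableP; split.
  by apply/measurable_EFinP; exact: continuous_borel_measurable.
under eq_integral do rewrite /= ger0_norm //.
rewrite ltey; apply: contra nz => /eqP oo.
by rewrite /Rintegral oo.
Qed.
End BorelMeasurable.

(** * Continuity and differentiability in charts *)

Lemma near_differentiable (K : numFieldType) (V W : normedModType K) (f g : V -> W) (x : V) :
  (\forall y \near x, f y = g y) -> differentiable f x -> differentiable g x.
Proof.
move=> fg df.
have fgx : f x = g x by exact: nbhs_singleton fg.
have g_expansion : g \o shift x = cst (g x) + 'd f x +o_ 0 id.
  apply/eqaddoP => e e0.
  have /eqaddoP/(_ e e0) := diff_locally df.
  have : \forall h \near 0, f (h + x) = g (h + x) by move: fg; rewrite (near_shift 0) subr0.
  apply: filterS2 => k /= fgk.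
  by rewrite /= !fctE /= -fgk -fgx.
apply/diff_locallyP; have -> : 'd g x = 'd f x :> (V -> W).
  by apply: diff_unique => //; exact: diff_continuous.
by split=> //; exact: diff_continuous.
Qed.

Section Continuity.
Variable R : realType.

Lemma continuous_Re : continuous (@complex.Re R : (R[i])^o -> R).
Proof.
move=> z A /nbhs_ballP[e e0 eA].
apply/(@nbhs_ballP _ (R[i])^o); exists e%:C; first by rewrite /= ltcR.
move=> w zw; apply: eA; rewrite /ball /= -ltcR.
have -> : complex.Re z - complex.Re w = complex.Re (z - w) by case: z {zw}; case: w.
exact: (le_lt_trans (normc_ge_Re _)) zw.
Qed.

Lemma continuous_Im : continuous (@complex.Im R : (R[i])^o -> R).
Proof.
move=> z A /nbhs_ballP[e e0 eA].
apply/(@nbhs_ballP _ (R[i])^o); exists e%:C; first by rewrite /= ltcR.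
move=> w zw; apply: eA; rewrite /ball /= -ltcR.
have -> : complex.Im z - complex.Im w = complex.Im (z - w) by case: z {zw}; case: w.
exact: (le_lt_trans (normc_ge_Im _)) zw.
Qed.

Lemma continuous_c2r n : continuous (@c2r R n : 'rV[(R[i] : numFieldType)]_n -> _).
Proof.
move=> z A /nbhs_ballP[e e0 eA].
apply/nbhs_ballP; exists e%:C; first by rewrite /= ltcR.
move=> w [_ bzw]; apply: eA; split=> // i j.
rewrite /c2r !mxE; case: splitP => k _; rewrite !mxE /ball /= -ltcR.
  have -> : complex.Re (z i k) - complex.Re (w i k) = complex.Re (z i k - w i k).
    by case: (z i k); case: (w i k).
  exact: (le_lt_trans (normc_ge_Re _)) (bzw i k).
have -> : complex.Im (z i k) - complex.Im (w i k) = complex.Im (z i k - w i k).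
  by case: (z i k); case: (w i k).
exact: (le_lt_trans (normc_ge_Im _)) (bzw i k).
Qed.

Lemma c2rK n : cancel (@c2r R n) (@r2c R n).
Proof.
move=> z; apply/rowP => j; rewrite /r2c mxE /c2r row_mxEl row_mxEr !mxE.
by case: (z 0 j).
Qed.

(** Stated from the individual clauses of a chart, so that it applies to the
    complex charts of the manifold and to the real charts derived from them
    alike. *)
Lemma chart_continuous (K : numFieldType) (M : topologicalType) m (c : chart K M m)
    (W : topologicalType) (f : M -> W) x :
    open (chart_dom c) -> chart_dom c x ->
    {in chart_dom c, cancel c (chart_inv c)} -> {for x, continuous c} ->
    {for c x, continuous (fun z => f (chart_inv c z))} ->
  {for x, continuous f}.
Proof.
move=> oc cx cK cc cf.
move=> A; rewrite /= -(cK x) ?inE // => /cf/cc; rewrite cK ?inE // => nA.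
have nc : nbhs x (chart_dom c) by apply: open_nbhs_nbhs.
rewrite /nbhs /=; apply: filterS2 nc nA => y cy /=.
by rewrite cK // inE.
Qed.

End Continuity.

Section ComplexContinuity.
Variables (R : realType).

(** Componentwise, because the smoothness of the metric and the integral of a
    complex function are given in terms of real and imaginary parts. *)
Definition complex_continuous_at (M : topologicalType) (x : M) (f : M -> R[i]) : Prop :=
  {for x, continuous (fun y => complex.Re (f y) : R)} /\
  {for x, continuous (fun y => complex.Im (f y) : R)}.

Lemma complex_continuousM (M : topologicalType) (x : M) f g :
  complex_continuous_at x f -> complex_continuous_at x g ->
  complex_continuous_at x (fun y => f y * g y).
Proof.
move=> [fR fI] [gR gI]; split.
  rewrite (_ : (fun y => _) = (fun y => complex.Re (f y) * complex.Re (g y)) -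
     (fun y => complex.Im (f y) * complex.Im (g y))); last by apply/funext => y; rewrite ReM.
  by apply: continuousB; apply: continuousM.
rewrite (_ : (fun y => _) = (fun y => complex.Re (f y) * complex.Im (g y)) +
     (fun y => complex.Im (f y) * complex.Re (g y))); last by apply/funext => y; rewrite ImM.
by apply: continuousD; apply: continuousM.
Qed.

Lemma complex_continuous_conj (M : topologicalType) (x : M) f :
  complex_continuous_at x f -> complex_continuous_at x (fun y => (f y)^*%C).
Proof.
move=> [fR fI]; split.
  by rewrite (_ : (fun y => _) = (fun y => complex.Re (f y))) //; apply/funext => y; case: (f y).
rewrite (_ : (fun y => _) = - (fun y => complex.Im (f y))); last first.
  by apply/funext => y; rewrite fctE; case: (f y).
exact: continuousN.
Qed.

Lemma near_continuous_at (M N : topologicalType) (x : M) (f g : M -> N) :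
  (\forall y \near x, f y = g y) -> {for x, continuous f} -> {for x, continuous g}.
Proof.
move=> fg cf A; rewrite -(nbhs_singleton fg) => /cf fA.
by rewrite /nbhs /=; apply: filterS2 fg fA => y /= <-.
Qed.

Lemma near_complex_continuous_at (M : topologicalType) (x : M) f g :
  (\forall y \near x, f y = g y) -> complex_continuous_at x f -> complex_continuous_at x g.
Proof.
move=> fg [fR fI].
split; [apply: near_continuous_at fR|apply: near_continuous_at fI];
  by apply: filterS fg => y ->.
Qed.

Variables (n : nat) (X : complexManifold R n).

Lemma hol_chart_at (x : X) : exists a, [/\ hol_atlas X a, is_chart a & chart_dom a x].
Proof.
have [_ _ [[charts cover _] _]] := cm_manifold X.
by have [a aX ax] := cover x; exists a; split=> //; exact: charts.
Qed.

Lemma holomorphic_complex_continuous (U : set X) f x :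
  holomorphic_fun U f -> U x -> complex_continuous_at x f.
Proof.
move=> hf Ux; have [a [aX [oa _ aK ac _] ax]] := hol_chart_at x.
have axK : chart_inv a (a x) = x by rewrite aK // inE.
have /differentiable_continuous fc :
    differentiable (fun z => f (chart_inv a z) : (R[i])^o) (a x).
  by apply: (hf a aX); split; [exists x | rewrite /= axK].
split; apply: (@chart_continuous _ X _ a) => //; do ?[by apply: ac; rewrite inE].
  exact: (continuous_comp fc (@continuous_Re _ _)).
exact: (continuous_comp fc (@continuous_Im _ _)).
Qed.

Lemma smooth_complex_continuous (U : set X) f x :
  complex_smooth_fun (real_atlas X) U f -> U x -> complex_continuous_at x f.
Proof.
move=> [fR fI] Ux; have [a [aX [oa _ aK ac _] ax]] := hol_chart_at x.
have axK : chart_inv a (r2c (c2r (a x))) = x by rewrite c2rK aK // inE.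
have aXr : real_atlas X (real_chart a) by exists a.
have rax : {for x, continuous (real_chart a)}.
  by apply: continuous_comp; [apply: ac; rewrite inE | exact: continuous_c2r].
have Ua : real_chart a x \in chart_cod (real_chart a) `&` (chart_inv (real_chart a) @^-1` U).
  by rewrite inE; split; [exists x | rewrite /= axK].
split; apply: (@chart_continuous _ X _ (real_chart a)) => //.
- by move=> y ya /=; rewrite c2rK aK.
- exact: (fR _ aXr 0%N _ Ua).
- by move=> y ya /=; rewrite c2rK aK.
- exact: (fI _ aXr 0%N _ Ua).
Qed.

Variables (L : holLineBundle X) (h : hermitianStructure L).

Lemma herm_scale x (c : R[i]) (v w : L x) : h x v (c *: w) = c * h x v w.
Proof. exact: (linear_funZ (herm_linear h v)). Qed.

Lemma herm_conj_scale x (c : R[i]) (v w : L x) : h x (c *: v) w = c^*%C * h x v w.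
Proof. by rewrite herm_conj herm_scale rmorphM /= -herm_conj. Qed.

(** A local trivialization gives the frame [tr_inv t x 1], in which every
    vector has its trivialized value as coefficient. *)
Lemma trivialization_frame t x (v : L x) : trivs t -> tr_dom t x ->
  v = tr_fun t v *: tr_inv t x 1.
Proof.
move=> tT tx; have [_ /(_ x tx)[lin trK invK]] := trivsP tT.
by apply: (can_inj trK); rewrite (linear_funZ lin) invK; exact/esym/mulr1.
Qed.

(** In a local frame e the pairing is conj(f) f' (e, e), where f and f' are the
    holomorphic coefficients of the sections and (e, e) is smooth. *)
Lemma herm_sections_continuous (s s' : sections L) x :
  hol_sections L s -> hol_sections L s' ->
  complex_continuous_at x (fun y => h y (s y) (s' y)).
Proof.
move=> sH s'H; have [t tT tx] := trivs_cover L x.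
have ot : open (tr_dom t) by have [] := trivsP tT.
pose F y := (tr_fun t (s y))^*%C * (tr_fun t (s' y) * h y (tr_inv t y 1) (tr_inv t y 1)).
apply: (@near_complex_continuous_at _ _ F).
  have nt : nbhs x (tr_dom t) by apply: open_nbhs_nbhs.
  apply: filterS nt => y ty; rewrite /F.
  by rewrite [in RHS](trivialization_frame (s y) tT ty)
    [in RHS](trivialization_frame (s' y) tT ty)
    herm_conj_scale herm_scale.
apply: complex_continuousM.
  exact/complex_continuous_conj/(holomorphic_complex_continuous (sH _ tT)).
apply: complex_continuousM; first exact: (holomorphic_complex_continuous (s'H _ tT)).
exact: (smooth_complex_continuous (herm_smooth h tT)).
Qed.
End ComplexContinuity.

(** * The action on sections *)

Section SectionAction.
Variables (R : realType) (G : lieGroup R) (n : nat) (X : complexManifold R n).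
Variables (L : holLineBundle X) (h : hermitianStructure L) (a : lieAction G X).
Variable rho : unitaryLift h a.

(** Points of L lying over provably but not definitionally equal base points
    are compared in the total space; proof irrelevance brings an equality
    there back to the fibre. *)
Lemma total_pt_inj x : injective (@total_pt R n X L x).
Proof.
move=> v w vw; have /= := projT2_eq vw.
by rewrite (Prop_irrelevance (projT1_eq vw) erefl).
Qed.

Lemma act_Kinv g x : a (g^-1)%g (a g x) = x.
Proof. by rewrite -act_mul mulVg act_one. Qed.

(** Evaluated at a translate g x, the transport in the definition of the action
    disappears.  As every point is such a translate, this determines g . s. *)
Lemma section_act_translate g s x : section_act rho g s (a g x) = rho g x (s x).
Proof.
apply: total_pt_inj; rewrite /section_act.
move: (act_invK a g (a g x)); rewrite act_Kinv => e.
by rewrite (Prop_irrelevance e erefl).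
Qed.

Lemma section_act_linear g : linear (section_act rho g).
Proof.
move=> c s t; apply: functional_extensionality_dep => x.
rewrite -(act_invK a g x).
rewrite -[RHS]/(c *: section_act rho g s _ + section_act rho g t _).
by rewrite !section_act_translate lift_linear.
Qed.

Lemma section_actVK g s : section_act rho g (section_act rho (g^-1)%g s) = s.
Proof.
apply: functional_extensionality_dep => x; apply: total_pt_inj.
transitivity (total_pt (section_act rho g (section_act rho (g^-1)%g s) (a g (a (g^-1)%g x)))).
  by rewrite act_invK.
by rewrite !section_act_translate -lift_mul mulgV lift_one.
Qed.

Lemma section_act_unitary g s s' x :
  h (a g x) (section_act rho g s (a g x)) (section_act rho g s' (a g x)) = h x (s x) (s' x).
Proof. by rewrite !section_act_translate lift_unitary. Qed.

(** Unitarity of the lift: applying g to both arguments of the right-hand side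
    gives the left-hand side, since g . (g^-1 . s) = s. *)
Lemma section_act_adjoint g s x (v : L x) :
  h (a g x) (s (a g x)) (rho g x v) = h x (section_act rho (g^-1)%g s x) v.
Proof.
by rewrite -(lift_unitary rho g (section_act rho (g^-1)%g s x)) -section_act_translate section_actVK.
Qed.

(** Near a point x, write y = g^-1 x and let e be a frame around y.  The section
    g . s has coefficient phi(y) psi(y) at x, where phi is the coefficient of s
    in e and psi is the coefficient of g e; both are holomorphic in y, and y is
    holomorphic in x. *)
Lemma section_act_holomorphic g s :
  hol_sections L s -> hol_sections L (section_act rho g s).
Proof.
move=> sH t tT b bX z [bz tz]; rewrite /= in tz.
set x0 := chart_inv b z in tz; set y0 := a (g^-1)%g x0.
have [u uT uy] := trivs_cover L y0.
have [c [cX [oc _ cK _ _] cy]] := hol_chart_at y0.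
have [[charts _ _] _] := let: And3 _ _ m := cm_manifold X in m.
have [ob _ bK _ binvC] := charts _ bX.
have cKy : chart_inv c (c y0) = y0 by rewrite cK // inE.
have [actC actD] := lift_base_holomorphic rho (g^-1)%g.
pose phi w := tr_fun u (s (chart_inv c w)) : (R[i])^o.
pose psi w := tr_fun t (rho g _ (tr_inv u (chart_inv c w) 1)) : (R[i])^o.
pose kappa := local_expr b c (a (g^-1)%g).
have dkappa : differentiable kappa z by apply: (actD _ _ bX cX); split.
have dphi : differentiable phi (kappa z).
  by apply: (sH u uT c cX); split; [exists y0 | rewrite /= cKy].
have dpsi : differentiable psi (kappa z).
  apply: (lift_holomorphic rho uT tT cX); split; first by exists y0.
  by rewrite /= cKy; split=> //; rewrite /= act_invK.
apply: (@near_differentiable _ _ _ (fun w => phi (kappa w) * psi (kappa w))); last first.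
  exact: (differentiableM (differentiable_comp dkappa dphi) (differentiable_comp dkappa dpsi)).
have binv : {for z, continuous (chart_inv b)} by apply: binvC; rewrite inE.
have nbhs_pull (D : set X) : open D -> D y0 ->
    \forall w \near z, D (a (g^-1)%g (chart_inv b w)).
  move=> oD Dy; apply: (continuous_comp binv (actC _)); exact: open_nbhs_nbhs.
have [ot _] := trivsP tT; have [ou uP] := trivsP uT.
have nt : \forall w \near z, tr_dom t (chart_inv b w) by apply: binv; exact: open_nbhs_nbhs.
apply: filterS3 nt (nbhs_pull _ oc cy) (nbhs_pull _ ou uy) => w tw cw uw.
rewrite /phi /psi /kappa /local_expr cK ?inE //.
rewrite -[in RHS](act_invK a g (chart_inv b w)).
rewrite -(act_invK a g (chart_inv b w)) in tw.
move: (a (g^-1)%g (chart_inv b w)) tw uw {cw} => y ty uy'.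
rewrite section_act_translate [in RHS](trivialization_frame (s y) uT uy').
have [_ /(_ _ ty)[lin _ _]] := trivsP tT.
rewrite (linear_funZ (@lift_linear _ _ _ _ _ _ _ rho g y)).
exact/esym/(linear_funZ lin).
Qed.

End SectionAction.

(** * Integrability of the pairings and traces on the fibres *)

Section HolSections.
Variables (R : realType) (n : nat) (X : complexManifold R n).
Variables (L : holLineBundle X) (h : hermitianStructure L).

Lemma section_sumE (I : Type) (r : seq I) (c : I -> R[i]) (s : I -> sections L) x :
  (\sum_(i <- r) c i *: s i) x = \sum_(i <- r) c i *: s i x.
Proof. exact: (@linear_fun_sum _ _ _ (fun s : sections L => s x)). Qed.

(** [tr_fun t] is linear only on the fibres over [tr_dom t], so the trivialized
    sum agrees with the sum of the trivialized sections only locally. *)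
Lemma hol_sections_sum m (c : 'I_m -> R[i]) (s : 'I_m -> sections L) :
  (forall i, hol_sections L (s i)) -> hol_sections L (\sum_i c i *: s i).
Proof.
move=> sH t tT b bX z [bz tz]; rewrite /= in tz.
have [[charts _ _] _] := let: And3 _ _ k := cm_manifold X in k.
have [ob _ bK _ binvC] := charts _ bX.
have binv : {for z, continuous (chart_inv b)} by apply: binvC; rewrite inE.
have [ot tP] := trivsP tT.
have nt : \forall w \near z, tr_dom t (chart_inv b w) by apply: binv; exact: open_nbhs_nbhs.
pose f i w := tr_fun t (s i (chart_inv b w)) : (R[i])^o.
apply: (@near_differentiable _ _ _ (\sum_i c i *: f i)).
  apply: filterS nt => w /tP[lin _ _]; rewrite section_sumE.
  by rewrite fct_sumE; apply/esym/(linear_fun_sum lin).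
apply: differentiable_sum => i; apply: differentiableZ.
by apply: (sH i t tT b bX); split.
Qed.

Lemma herm0 x (v : L x) : h x v 0 = 0.
Proof. by rewrite -(scale0r 0) herm_scale mul0r. Qed.

Lemma herm_ge0 x (v : L x) : 0 <= h x v v.
Proof.
have [->|v0] := eqVneq v 0; first by rewrite herm0.
exact/ltW/herm_pos.
Qed.

Lemma hermD x (v w w' : L x) : h x v (w + w') = h x v w + h x v w'.
Proof. by have := herm_linear h v 1 w w'; rewrite !scale1r. Qed.

Lemma hermDl x (v v' w : L x) : h x (v + v') w = h x v w + h x v' w.
Proof. by rewrite herm_conj hermD rmorphD /= -!herm_conj. Qed.

(** Expand 0 <= |v + z w|^2.  The choices z = 1 and z = -1 bound the real part
    of (v, w); replacing v by i v then bounds the imaginary part.  This weak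
    form of the Cauchy-Schwarz inequality gives the integrability of (s, s')
    from that of |s|^2 and |s'|^2. *)
Lemma herm_cross_le x (z : R[i]) (v w : L x) : z * z^*%C = 1 ->
  - complex.Re (z * h x v w) <= complex.Re (h x v v) + complex.Re (h x w w).
Proof.
move=> z1; have := herm_ge0 (v + z *: w).
rewrite hermD !hermDl !herm_scale !herm_conj_scale (mulrA z) z1 mul1r.
rewrite lecE => /andP[_]; rewrite !ReD [complex.Re 0]/=.
have -> : complex.Re (z^*%C * h x w v) = complex.Re (z * h x v w).
  rewrite (herm_conj h w v); case: z {z1}; case: (h x v w) => p q r t /=.
  by rewrite !mulNr mulrN opprK.
have := herm_ge0 v; have := herm_ge0 w; rewrite !lecE => /andP[_ /= w0] /andP[_ /= v0].
by lra.
Qed.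

Lemma normr_Re_herm_le x (v w : L x) :
  `|complex.Re (h x v w)| <= complex.Re (h x v v) + complex.Re (h x w w).
Proof.
rewrite ler_norml; apply/andP; split.
  rewrite lerNl -[h x v w]mul1r; apply: herm_cross_le.
  by rewrite rmorph1 mulr1.
rewrite -[complex.Re (h x v w)]opprK.
have -> : - complex.Re (h x v w) = complex.Re (-1 * h x v w).
  by rewrite mulN1r; case: (h x v w).
by apply: herm_cross_le; rewrite rmorphN rmorph1 mulrNN mulr1.
Qed.

Lemma normr_Im_herm_le x (v w : L x) :
  `|complex.Im (h x v w)| <= complex.Re (h x v v) + complex.Re (h x w w).
Proof.
have -> : complex.Im (h x v w) = complex.Re (- 'i%C * h x v w).
  by case: (h x v w) => p q /=; rewrite oppr0 mul0r sub0r mulN1r opprK.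
have -> : - 'i%C * h x v w = h x ('i%C *: v) w.
  rewrite herm_conj_scale; congr (_ * _); apply/eqP.
  by rewrite eq_complex /= oppr0 !eqxx.
apply: le_trans (normr_Re_herm_le _ _) _.
rewrite herm_scale herm_conj_scale mulrA (_ : 'i%C * 'i%C^*%C = 1) ?mul1r //.
by apply/eqP; rewrite eq_complex /= !mul0r mulrN mul1r opprK add0r mulr0 addr0 !eqxx.
Qed.

Variable vol : {measure set (borel X) -> \bar R}.

Lemma herm_sections_integrable s s' : hol_sections L s -> hol_sections L s' ->
    section_inner h vol s s = 1 -> section_inner h vol s' s' = 1 ->
  complex_integrable vol (fun x : borel X => h x (s x) (s' x)).
Proof.
have diag u : hol_sections L u -> section_inner h vol u u = 1 ->
    vol.-integrable setT (EFin \o (fun x : borel X => complex.Re (h x (u x) (u x)))).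
  move=> uH u1; apply: ge0_Rintegral_neq0_integrable.
  - by move=> x; have [] := herm_sections_continuous h x uH uH.
  - by move=> x; have := herm_ge0 (u x); rewrite lecE => /andP[].
  - by move: u1; rewrite /section_inner /complex_integral => -[-> _]; exact: oner_neq0.
have cont u x : hol_sections L u -> {for x, continuous (fun y => complex.Re (h y (u y) (u y)))}.
  by move=> uH; have [] := herm_sections_continuous h x uH uH.
move=> sH s'H s1 s'1.
pose F x := complex.Re (h x (s x) (s x)) + complex.Re (h x (s' x) (s' x)).
have cF : continuous (F : X -> R) by move=> x; apply: continuousD; exact: cont.
have iF : vol.-integrable setT (EFin \o (F : borel X -> R)).
  rewrite (_ : _ \o _ = (EFin \o (fun x : borel X => complex.Re (h x (s x) (s x)))) \+
    (EFin \o (fun x : borel X => complex.Re (h x (s' x) (s' x)))))%E //.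
  by apply: integrableD => //; exact: diag.
split; apply: (@dominated_integrable _ _ _ _ F) => // x.
- by have [] := herm_sections_continuous h x sH s'H.
- exact: normr_Re_herm_le.
- by have [] := herm_sections_continuous h x sH s'H.
- exact: normr_Im_herm_le.
Qed.

(** A sum of operators of rank one on the line L_x; the frame of a local
    trivialization serves as the basis in which the trace is computed. *)
Lemma trace_on_fiber x m (l : 'I_m -> L x -> R[i]) (u : 'I_m -> L x) :
    (forall i, linear (l i : L x -> (R[i])^o)) ->
  trace_on [set: L x] (fun v => \sum_i l i v *: u i) = \sum_i l i (u i).
Proof.
move=> linl; have [t tT tx] := trivs_cover L x.
have [_ /(_ x tx)[lin trK invK]] := trivsP tT.
set e := tr_inv t x 1.
rewrite (@trace_onE _ _ _ _ 1 (fun=> e) (\sum_i l i e * tr_fun t (u i))%:M).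
- rewrite mxtrace_scalar mulr1n; apply: eq_bigr => i _.
  rewrite [in RHS](trivialization_frame (u i) tT tx) (linear_funZ (linl i)).
  exact: mulrC.
- move=> c v w; rewrite scaler_sumr -big_split; apply: eq_bigr => i _ /=.
  by rewrite linl scalerDl scalerA.
- split=> // v _; exists (const_mx (tr_fun t v)); split.
    by rewrite big_ord1 mxE; exact: trivialization_frame.
  move=> c ->; apply/rowP => i; rewrite ord1 mxE big_ord1 (linear_funZ lin) invK.
  exact: mulr1.
- by [].
- move=> j; rewrite big_ord1 mxE [j]ord1 eqxx mulr1n scaler_suml; apply: eq_bigr => i _.
  by rewrite [in LHS](trivialization_frame (u i) tT tx) scalerA.
Qed.

End HolSections.

(** * The geometric character *)

Section GeometricCharacter.
Variables (R : realType) (G : lieGroup R) (n : nat) (X : complexManifold R n).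
Variables (L : holLineBundle X) (h : hermitianStructure L) (a : lieAction G X).
Variable rho : unitaryLift h a.
Hypothesis X_compact : compact [set: X].

(** With N = |s|^2 the eigenvalue equation reads |z|^2 N(g x) = N(x).  If N is
    maximal at c, taking x = g^-1 c gives |z|^2 N(c) <= N(c), and taking x = c
    gives N(c) <= |z|^2 N(c). *)
Lemma section_act_eigenvalue_norm g (s : sections L) (z : R[i]) :
    hol_sections L s -> s != 0 -> section_act rho g s = z *: s ->
  `|z| = 1.
Proof.
move=> sH s0 sz; pose N x := complex.Re (h x (s x) (s x)).
have hN x : h x (s x) (s x) = (N x)%:C.
  by have := herm_ge0 h (s x) => /ger0_Im; rewrite /N; case: (h x _ _) => p q /= ->.
have cN : continuous (N : X -> R).
  by move=> x; have [] := herm_sections_continuous h x sH sH.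
have Nact x : `|z| ^+ 2 * (N (a g x))%:C = (N x)%:C.
  rewrite -!hN -(section_act_unitary rho g s s x) sz sqr_normc.
  by rewrite -[(z *: s) _]/(z *: s _) herm_scale herm_conj_scale mulrA.
have [|c _ cmax] := compact_EVT_max _ X_compact (continuous_subspaceT cN).
  by exists point.
have {}cmax x : N x <= N c by apply: cmax; rewrite inE.
have Nc : 0 < N c.
  have [x sx] : exists x, s x != 0.
    apply: contrapT => /forallNP s0'; case/eqP: s0.
    apply: functional_extensionality_dep => x.
    by apply/eqP; rewrite -[_ == _]negbK; apply/negP/s0'.
  apply: lt_le_trans (cmax x); have := herm_pos h sx.
  by rewrite hN ltcR.
have NcC : 0 < (N c)%:C by rewrite ltcR.
apply/eqP; rewrite -sqrp_eq1 // eq_le; apply/andP; split.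
  by rewrite -(ler_pM2r NcC) mul1r -{1}(act_invK a g c) Nact lecR.
rewrite -(ler_pM2r NcC) mul1r -{1}(Nact c) ler_wpM2l ?exprn_ge0 //.
by rewrite lecR.
Qed.

Variable vol : {measure set (borel X) -> \bar R}.
Variables (m : nat) (s : 'I_m -> sections L).
Hypothesis s_orthonormal : is_orthonormal_basis h vol s.

Let s_basis : is_basis_of (hol_sections L) s := s_orthonormal.1.
Let sH i : hol_sections L (s i) := s_basis.1 i.

(** The integrand is sum_(i, k) conj(B_ki) (s_k, s_i), whose integral reduces to
    its diagonal terms by orthonormality.  The conjugate appears because g^-1
    acts in the first, antilinear, argument of the inner product. *)
Lemma geometric_character_trace_inverse g (B : 'M[R[i]]_m) :
    (forall j, section_act rho (g^-1)%g (s j) = \sum_i B i j *: s i) ->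
  geometric_character rho vol s g = (\tr B)^*%C.
Proof.
move=> EB; rewrite /geometric_character.
have s1 i : section_inner h vol (s i) (s i) = 1 by rewrite s_orthonormal.2 eqxx.
have int_s i j := herm_sections_integrable (sH i) (sH j) (s1 i) (s1 j).
under eq_fun => x.
  rewrite (_ : associated_kernel rho s g x (x:=x) =
     fun v : L x => \sum_i h x (section_act rho (g^-1)%g (s i) x) v *: s i x); last first.
    by apply/funext => v; apply: eq_bigr => i _; rewrite section_act_adjoint.
  rewrite trace_on_fiber; last by move=> i; exact: herm_linear.
  under eq_bigr => i _.
    rewrite EB section_sumE herm_conj linear_fun_sum; last exact: herm_linear.
    rewrite rmorph_sum /=.
    under eq_bigr do rewrite rmorphM /= -herm_conj.
    over.
  over.
have int_B i := complex_integral_sum (index_enum 'I_m)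
  (fun k => complex_integrableZ (B k i)^*%C (int_s k i)).
rewrite (complex_integral_sum _ (fun i => (int_B i).1)).2 /mxtrace rmorph_sum.
apply: eq_bigr => i _; rewrite (int_B i).2 (bigD1 i) //= big1 => [|k ki].
  rewrite complex_integralZ // addr0.
  by rewrite -/(section_inner h vol (s i) (s i)) s1 mulr1.
rewrite complex_integralZ // -/(section_inner h vol (s k) (s i)) s_orthonormal.2.
by rewrite (negPf ki) mulr0.
Qed.

End GeometricCharacter.


Theorem proposition2p15 (R : realType) (G : lieGroup R)
  (n : nat) (X : complexManifold R n) (X_compact : compact [set: X])
  (H : hermitianMetric X)
  (vol : {measure set (borel X) -> \bar R})
  (vol_riemannian : is_riemannian_volume H vol)
  (L : holLineBundle X) (h : hermitianStructure L)
  (a : lieAction G X)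
  (a_isometry : forall g : G, is_isometry H (a g))
  (a_oriented : forall g : G, orientation_preserving (a g))
  (rho : unitaryLift h a)
  (m : nat) (s : 'I_m -> sections L)
  (s_orthonormal : is_orthonormal_basis h vol s) :
  forall g : G,
    geometric_character rho vol s g =
    trace_on (hol_sections L) (section_act rho g).
Proof.
move=> g; have s_basis := s_orthonormal.1; have sH i := s_basis.1 i.
have actH k u : hol_sections L u -> hol_sections L (section_act rho k u).
  exact: section_act_holomorphic.
have [A EA] := basis_matrix s_basis (fun j => actH g _ (sH j)).
have [B EB] := basis_matrix s_basis (fun j => actH (g^-1)%g _ (sH j)).
have act_comb p (c : 'I_p -> R[i]) u : section_act rho g (\sum_i c i *: u i) =
    \sum_i c i *: section_act rho g (u i).
  exact: (linear_fun_sum (section_act_linear rho g)).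
have AB : A *m B = 1%:M.
  have E j : \sum_i (A *m B) i j *: s i = s j.
    by rewrite -(comb_mulmx _ _ EA) -act_comb -EB section_actVK.
  by apply: (basis_mx_inj s_basis) => j; rewrite E; [exact: sH|exact: basis_mx1].
rewrite (geometric_character_trace_inverse s_orthonormal EB).
rewrite (trace_onE (section_act_linear rho g) s_basis (actH g) EA).
rewrite -(mxtrace_tr A) -(mxtrace_tr B).
apply: conj_trace_inverse; first by rewrite -trmx_mul AB trmx1.
(* [eigenvalueP] yields a row vector acted on from the right; for the transpose
   of A, its entries are the coordinates of an eigensection. *)
move=> z /eigenvalueP[v vA v0].
have zE : section_act rho g (\sum_i v 0 i *: s i) = z *: \sum_i v 0 i *: s i.
  rewrite act_comb scaler_sumr.
  have -> : \sum_i v 0 i *: section_act rho g (s i) =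
      \sum_i v^T i 0 *: section_act rho g (s i) by apply: eq_bigr => i _; rewrite mxE.
  rewrite (comb_mulmx v^T 0 EA); apply: eq_bigr => i _.
  by rewrite -[A]trmxK -trmx_mul vA !mxE scalerA.
apply: (section_act_eigenvalue_norm X_compact (hol_sections_sum _ sH) _ zE).
apply: contra v0 => /eqP sum0.
apply/eqP/rowP => i; rewrite mxE.
apply: (basis_coords_inj s_basis (d := fun=> 0) (hol_sections_sum _ sH)).
by rewrite sum0 big1 // => j _; rewrite scale0r.
Qed.
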